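(* Let $\mathbb{K}$ be a non-Archimedean valued field with valuation $|\cdot|$, let $n\geq 2$ be an integer, and let $p(z)=c_0+c_1z+\cdots+c_{n-1}z^{n-1}+z^n\in\mathbb{K}[z]$. If $\lambda\in\mathbb{K}$ is a zero of $p$, then $$|\lambda|\leq 1$$ or $$|\lambda|\,|\lambda+c_{n-1}|\leq \max\{|c_0|,\dots,|c_{n-2}|\}.$$
   Context: A non-Archimedean valued field is a field $\mathbb{K}$ with a map $|\cdot|:\mathbb{K}\to[0,\infty)$ such that $|x|=0$ iff $x=0$, $|xy|=|x||y|$, and $|x+y|\leq\max\{|x|,|y|\}$ for all $x,y\in\mathbb{K}$. *)

(* Defs.v *)
From HB Require Import structures.
From mathcomp Require Import all_boot all_order all_algebra.
From mathcomp Require Import reals.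
Set Implicit Arguments. Unset Strict Implicit. Unset Printing Implicit Defensive.
Import Order.TTheory GRing.Theory Num.Theory.
Local Open Scope ring_scope.

Record nonarchimedean_valuation (R : realType) (K : fieldType) (v : K -> R)
    : Prop := NonarchimedeanValuation {
  nav_ge0 : forall x, 0 <= v x;
  nav_eq0 : forall x, v x = 0 <-> x = 0;
  navM : forall x y, v (x * y) = v x * v y;
  navD : forall x y, v (x + y) <= Num.max (v x) (v y)
}.

(* Main.v *)
Require Import Defs.
From HB Require Import structures.
From mathcomp Require Import all_boot all_order all_algebra.
From mathcomp Require Import reals.
Set Implicit Arguments. Unset Strict Implicit. Unset Printing Implicit Defensive.
Import Order.TTheory GRing.Theory Num.Theory.
Local Open Scope ring_scope.

(** Separating the two leading terms of [p(lambda) = 0] gives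
    [lambda^(n-1) (lambda + c_(n-1)) = - sum_(i < n-1) c_i lambda^i].  If
    [|lambda| > 1], every power of [lambda] on the right has absolute value at
    most [|lambda|^(n-2)], so the ultrametric inequality ([nav_sum_le]) bounds
    the right-hand side in absolute value by [M |lambda|^(n-2)], where [M] is the largest of the
    [|c_i|], [i <= n-2].  By multiplicativity ([navX]) the left-hand side has
    absolute value [|lambda|^(n-2)] times [|lambda| |lambda + c_(n-1)|]; cancelling the
    positive factor [|lambda|^(n-2)] gives the claim. *)

Section ValuationTheory.

Variables (R : realType) (K : fieldType) (v : K -> R).
Hypothesis hv : nonarchimedean_valuation v.

Lemma nav0 : v 0 = 0.
Proof. exact/(nav_eq0 hv). Qed.

(** [v 1] is a nonzero idempotent of a field. *)
Lemma nav1 : v 1 = 1.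
Proof.
have v1_neq0 : v 1 != 0.
  by apply/eqP => /(nav_eq0 hv)/eqP; rewrite oner_eq0.
by apply: (mulfI v1_neq0); rewrite -(navM hv) !mulr1.
Qed.

(** [v (-1)] is a nonnegative square root of [v 1 = 1]. *)
Lemma navN x : v (- x) = v x.
Proof.
have vN1 : v (-1) = 1.
  apply/eqP; rewrite -(pexpr_eq1 (n := 2)) ?(nav_ge0 hv) //.
  by rewrite expr2 -(navM hv) mulrNN mulr1 nav1.
by rewrite -mulN1r (navM hv) vN1 mul1r.
Qed.

Lemma navX x k : v (x ^+ k) = v x ^+ k.
Proof.
by elim: k => [|k IHk]; rewrite ?expr0 ?nav1 // !exprS (navM hv) IHk.
Qed.

Lemma nav_sum_le (I : Type) (r : seq I) (P : pred I) (F : I -> K) (B : R) :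
  0 <= B -> (forall i, P i -> v (F i) <= B) ->
  v (\sum_(i <- r | P i) F i) <= B.
Proof.
move=> B_ge0 leFB.
apply: (big_ind (fun x => v x <= B)) => //; first by rewrite nav0.
by move=> x y vx vy; apply: le_trans (navD hv x y) _; rewrite ge_max vx vy.
Qed.

End ValuationTheory.

Theorem theorem2p2 (R : realType) (K : fieldType) (v : K -> R)
    (hv : nonarchimedean_valuation v)
    (n : nat) (hn : (2 <= n)%N) (c : nat -> K) (p : {poly K})
    (hp : p = \sum_(i < n) c i *: 'X^i + 'X^n)
    (lambda : K) (hlambda : root p lambda) :
  v lambda <= 1 \/
  v lambda * v (lambda + c n.-1) <= \big[Num.max/0]_(i < n.-1) v (c i).
Proof.
have [|v_gt1] := leP (v lambda) 1; [by left | right].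
case: n hn hp => [|[|m]] // _ hp /=.
set M := \big[_/_]_(i < _) _.
have M_ge0 : 0 <= M by exact: bigmax_ge_id.
have vm_gt0 : 0 < v lambda ^+ m by rewrite exprn_gt0 // (lt_trans ltr01).
have leading_terms : lambda ^+ m.+1 * (lambda + c m.+1) =
    - \sum_(i < m.+1) c i * lambda ^+ i.
  apply/eqP; rewrite -addr_eq0 mulrDr -exprSr; move: hlambda.
  rewrite hp rootE hornerD hornerXn horner_sum big_ord_recr /= hornerZ hornerXn.
  under eq_bigr => i _ do rewrite hornerZ hornerXn.
  by rewrite [c m.+1 * _]mulrC addrC [X in X == 0 -> _]addrC addrA.
rewrite -(ler_pM2l vm_gt0) mulrA -exprSr -(navX hv _ m.+1) -(navM hv) leading_terms.
rewrite (navN hv) (nav_sum_le hv) ?mulr_ge0 ?(ltW vm_gt0) // => i _.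
rewrite (navM hv) (navX hv) mulrC.
apply: ler_pM; rewrite ?exprn_ge0 ?(nav_ge0 hv) //.
  by rewrite ler_weXn2l ?(ltW v_gt1) // -ltnS.
exact: (le_bigmax _ (fun i : 'I_m.+1 => v (c i))).
Qed.
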